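(* Let $f\colon X\to Y$ be a continuous map between locally compact Hausdorff spaces with unified space $(X\uplus_f Y,f_\uplus)$. There is a split extension $$0\to C_0(X)\to C_0(X\uplus_f Y)\xrightarrow{\;q\;}C_0(Y)\to 0,$$ where $q$ is the restriction of functions to $Y$ and the splitting of $q$ is the map $f_\uplus^*\colon C_0(Y)\to C_0(X\uplus_fY)$ dual to the proper map $f_\uplus$. The map $f^*\in\operatorname{Mor}(C_0(Y),C_0(X))$ is a lift of the Busby invariant of the split extension, and $$C_0(X\uplus_f Y)\cong\{(g,h)\in C_b(X)\oplus C_0(Y): g-f^*(h)\in C_0(X)\}.$$ Moreover, every split extension of $C_0(Y)$ by $C_0(X)$ is isomorphic to $C_0(X\uplus_f Y)$ for some continuous map $f\colon X\to Y$.
   Context: Unified space: $X\uplus_f Y$ is the set $X\sqcup Y$, with the map $f_\uplus\colon X\uplus_f Y\to Y$, $f_\uplus|_X=f$, $f_\uplus|_Y=\mathrm{id}_Y$, and the topology with base consisting of all open subsets of $X$ and all sets $f_\uplus^{-1}(V)\cap((X\sqcup Y)\setminus K)$ with $V\subseteq Y$ open and $K\subseteq X$ compact. It is a locally compact Hausdorff space, $X$ is open and $Y$ is closed in it, and $f_\uplus$ is continuous, proper and surjective. For $C^*$-algebras $A,B$, $\operatorname{Mor}(A,B)$ is the set of $*$-homomorphisms $\varphi\colon A\to\mathcal{M}(B)$ (multiplier algebra) with $\operatorname{span}\varphi(A)B$ dense in $B$. $\mathcal{M}(C_0(X))$ is identified with $C_b(X)$, and $f^*(a)=a\circ f$. An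 extension of $A$ by $B$ is a short exact sequence $0\to B\to E\to A\to0$ of $C^*$-algebras and $*$-homomorphisms ($E$ itself is also referred to as an extension). It is split if there is a $*$-homomorphism $s\colon A\to E$ with $q\circ s=\mathrm{id}_A$, where $q\colon E\to A$ is the quotient map. The ideal $B$ of $E$ induces $\alpha\colon E\to\mathcal{M}(B)$, $\alpha(e)b=eb$, which descends to a $*$-homomorphism $\beta\colon A\to\mathcal{M}(B)/B$, the Busby invariant of the extension; a lift of $\beta$ is a $*$-homomorphism $A\to\mathcal{M}(B)$ whose composition with the quotient map $\mathcal{M}(B)\to\mathcal{M}(B)/B$ is $\beta$.
   Formalization: In the last sentence the split extension is assumed to have a splitting s whose induced lift α∘s of the Busby invariant lies in Mor(C_0(Y),C_0(X)) (nondegenerate); without this the claim fails, e.g. for C_0(ℝ)⊕ℂ with X=ℝ, Y a point. *)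

(* Defs.v *)
From HB Require Import structures.
From mathcomp Require Import all_boot all_order all_algebra.
From mathcomp Require Import generic_quotient.
From mathcomp Require Import all_classical all_reals all_analysis.
From mathcomp Require Import complex ring.

Set Implicit Arguments.
Unset Strict Implicit.
Unset Printing Implicit Defensive.

Import Order.TTheory GRing.Theory Num.Theory.
Import numFieldNormedType.Exports.

Local Open Scope classical_set_scope.
Local Open Scope ring_scope.

HB.mixin Record Lmodule_isStarAlgebra (R : realType) A
    & GRing.Lmodule R[i] A := {
  smul : A -> A -> A ;
  star : A -> A ;
  smulA : associative smul ;
  smulDl : left_distributive smul +%R ;
  smulDr : right_distributive smul +%R ;
  smulZl : forall (c : R[i]) a b, smul (c *: a) b = c *: smul a b ;
  smulZr : forall (c : R[i]) a b, smul a (c *: b) = c *: smul a b ;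
  starK : involutive star ;
  starD : {morph star : a b / a + b} ;
  starZ : forall (c : R[i]) a, star (c *: a) = Num.conj c *: star a ;
  starM : forall a b, star (smul a b) = smul (star b) (star a)
}.

#[short(type="starAlgType")]
HB.structure Definition StarAlgebra (R : realType) :=
  {A of Lmodule_isStarAlgebra R A & GRing.Lmodule R[i] A}.

HB.mixin Record isCStarAlgebra (R : realType) A
    & StarAlgebra R A & CompleteNormedModule R[i] A := {
  normr_smul : forall a b : A, `|smul a b| <= `|a| * `|b| ;
  normr_star_smul : forall a : A, `|smul (star a) a| = `|a| ^+ 2
}.

#[short(type="cstarAlgType")]
HB.structure Definition CStarAlgebra (R : realType) :=
  {A of isCStarAlgebra R A & StarAlgebra R A & CompleteNormedModule R[i] A}.

Section complex_complete.
Variable R : realType.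
Local Notation C := (R[i]^o).

Lemma normc_real (a : R) : `|(a%:C)%C : R[i]| = (`|a|%:C)%C.
Proof. by rewrite normc_def /= expr0n addr0 sqrtr_sqr. Qed.

Lemma ler_normc_ReIm (z : R[i]) :
  `|z| <= ((`|complex.Re z| + `|complex.Im z|)%:C)%C.
Proof.
rewrite {1}[z]complexE (le_trans (ler_normD _ _)) // normrM complexiE normCi mul1r.
by rewrite !normc_real rmorphD.
Qed.

Lemma normc_ge_Im (z : R[i]) : (`|complex.Im z|%:C)%C <= `|z|.
Proof.
rewrite (_ : complex.Im z = complex.Re (- ('i%C * z))).
  by rewrite (le_trans (normc_ge_Re _)) // normrN normrM complexiE normCi mul1r.
by case: z => a b /=; rewrite mul0r mul1r sub0r opprK.
Qed.

Lemma complex_gt0P (e : R[i]) : 0 < e -> exists2 r : R, 0 < r & e = (r%:C)%C.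
Proof.
move=> e0; have /complex_realP[r re] : e \is Num.real by rewrite realE ltW.
by exists r => //; rewrite -ltcR -re.
Qed.

Lemma complex_complete (F : set_system C) : ProperFilter F -> cauchy F -> cvg F.
Proof.
move=> FF /cauchy_ballP Fc.
have FcT (T : C -> R) : (forall z w, (`|T z - T w|%:C)%C <= `|z - w|) ->
    cvg (T @ F).
  move=> TL; apply: cauchy_cvg; apply/cauchy_ballP => e e0.
  have eC : 0 < (e%:C)%C :> R[i] by rewrite ltcR.
  have [[A B] /= [FA FB] AB] := Fc _ eC.
  exists (T @` A, T @` B) => /=.
    by split; [apply: filterS FA|apply: filterS FB] => z ? /=; exists z.
  move=> [_ _] /= [[z Az <-] [w Bw <-]].
  have := AB (z, w) (conj Az Bw); rewrite /= -!ball_normE /= => zw.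
  by rewrite -ltcR (le_lt_trans (TL _ _)).
have /cvg_ex[/= a Fa] : cvg ((@complex.Re R) @ F).
  apply: FcT => z w; rewrite -raddfB; exact: normc_ge_Re.
have /cvg_ex[/= b Fb] : cvg ((@complex.Im R) @ F).
  apply: FcT => z w; rewrite -raddfB; exact: normc_ge_Im.
apply/cvg_ex; exists (Complex a b : C); apply/cvgrPdist_lt => e.
move=> /complex_gt0P[r r0 ->].
have r20 : 0 < r / 2 by rewrite divr_gt0.
move/cvgrPdist_lt : Fa => /(_ _ r20) Fa.
move/cvgrPdist_lt : Fb => /(_ _ r20) Fb.
near=> z; rewrite (le_lt_trans (ler_normc_ReIm _)) // ltcR.
rewrite [ltRHS]splitr !raddfB /=.
by apply: ltrD; near: z.
Unshelve. all: by end_near. Qed.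

End complex_complete.

Section fun_alg_def.
Variables (R : realType) (X : Type).

(* Sets of bounded functions that form a C*-algebra for the pointwise *)
(* operations and the supremum norm. *)
Record fun_cstar_closed (P : set (X -> R[i]^o)) : Prop := FunCStarClosed {
  fcc_bounded : forall f, P f -> exists M : R, forall x, `|f x| <= (M%:C)%C ;
  fcc0 : P (fun=> 0) ;
  fccD : forall f g, P f -> P g -> P (fun x => f x + g x) ;
  fccZ : forall (c : R[i]) f, P f -> P (fun x => c * f x) ;
  fccM : forall f g, P f -> P g -> P (fun x => f x * g x) ;
  fccJ : forall f, P f -> P (fun x => Num.conj (f x)) ;
  fcc_limit : forall f,
    (forall e : R, 0 < e ->
       exists2 g, P g & forall x, `|f x - g x| < (e%:C)%C) -> P f
}.

Structure fun_cstar := FunCStar {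
  fun_cstar_set :> set (X -> R[i]^o) ;
  fun_cstarP : fun_cstar_closed fun_cstar_set
}.

Record fun_alg (P : fun_cstar) := FunAlg {
  fun_alg_val :> X -> R[i]^o ;
  fun_algP : fun_cstar_set P fun_alg_val
}.

End fun_alg_def.

Section fun_alg_theory.
Variables (R : realType) (X : Type) (P : fun_cstar R X).
Local Notation A := (fun_alg P).
Implicit Types f g h : A.

HB.instance Definition _ := gen_eqMixin A.
HB.instance Definition _ := gen_choiceMixin A.

Lemma fun_alg_eq f g : (forall x, f x = g x) -> f = g.
Proof.
case: f g => [f Pf] [g Pg] /= fg; have {}fg : f = g by apply/funext.
by rewrite fg in Pf *; congr FunAlg; exact: Prop_irrelevance.
Qed.

Let closedP := fun_cstarP P.

Definition fa_zero : A := FunAlg (fcc0 closedP).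
Definition fa_add f g : A := FunAlg (fccD closedP (fun_algP f) (fun_algP g)).
Definition fa_scale (c : R[i]) f : A := FunAlg (fccZ closedP c (fun_algP f)).

Fact fa_opp_subproof f : fun_cstar_set P (fun x => - f x).
Proof.
rewrite (_ : (fun x => - f x) = (fun x => - 1 * f x)).
  exact: fccZ closedP _ _ (fun_algP f).
by apply/funext => x; rewrite mulN1r.
Qed.

Definition fa_opp f : A := FunAlg (fa_opp_subproof f).
Definition fa_mul f g : A := FunAlg (fccM closedP (fun_algP f) (fun_algP g)).
Definition fa_star f : A := FunAlg (fccJ closedP (fun_algP f)).

Fact fa_addA : associative fa_add.
Proof. by move=> f g h; apply: fun_alg_eq => x /=; rewrite addrA. Qed.
Fact fa_addC : commutative fa_add.
Proof. by move=> f g; apply: fun_alg_eq => x /=; rewrite addrC. Qed.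
Fact fa_add0 : left_id fa_zero fa_add.
Proof. by move=> f; apply: fun_alg_eq => x /=; rewrite add0r. Qed.
Fact fa_addN : left_inverse fa_zero fa_opp fa_add.
Proof. by move=> f; apply: fun_alg_eq => x /=; rewrite addNr. Qed.

HB.instance Definition _ :=
  GRing.isZmodule.Build A fa_addA fa_addC fa_add0 fa_addN.

Fact fa_scaleA (a b : R[i]) f :
  fa_scale a (fa_scale b f) = fa_scale (a * b) f.
Proof. by apply: fun_alg_eq => x /=; rewrite mulrA. Qed.
Fact fa_scale1 : left_id 1 fa_scale.
Proof. by move=> f; apply: fun_alg_eq => x /=; rewrite mul1r. Qed.
Fact fa_scaleDr : right_distributive fa_scale +%R.
Proof. by move=> c f g; apply: fun_alg_eq => x /=; rewrite mulrDr. Qed.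
Fact fa_scaleDl f : {morph fa_scale^~ f : a b / a + b}.
Proof. by move=> a b; apply: fun_alg_eq => x /=; rewrite mulrDl. Qed.

HB.instance Definition _ := GRing.Zmodule_isLmodule.Build R[i] A
  fa_scaleA fa_scale1 fa_scaleDr fa_scaleDl.

Fact fa_mulA : associative fa_mul.
Proof. by move=> f g h; apply: fun_alg_eq => x /=; rewrite mulrA. Qed.
Fact fa_mulDl : left_distributive fa_mul +%R.
Proof. by move=> f g h; apply: fun_alg_eq => x /=; rewrite mulrDl. Qed.
Fact fa_mulDr : right_distributive fa_mul +%R.
Proof. by move=> f g h; apply: fun_alg_eq => x /=; rewrite mulrDr. Qed.
Fact fa_mulZl (c : R[i]) f g : fa_mul (c *: f) g = c *: fa_mul f g.
Proof. by apply: fun_alg_eq => x /=; rewrite mulrA. Qed.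
Fact fa_mulZr (c : R[i]) f g : fa_mul f (c *: g) = c *: fa_mul f g.
Proof. by apply: fun_alg_eq => x /=; rewrite mulrCA. Qed.
Fact fa_starK : involutive fa_star.
Proof. by move=> f; apply: fun_alg_eq => x /=; rewrite conjCK. Qed.
Fact fa_starD : {morph fa_star : f g / f + g}.
Proof. by move=> f g; apply: fun_alg_eq => x /=; rewrite rmorphD. Qed.
Fact fa_starZ (c : R[i]) f : fa_star (c *: f) = Num.conj c *: fa_star f.
Proof. by apply: fun_alg_eq => x /=; rewrite rmorphM. Qed.
Fact fa_starM f g : fa_star (fa_mul f g) = fa_mul (fa_star g) (fa_star f).
Proof. by apply: fun_alg_eq => x /=; rewrite rmorphM mulrC. Qed.

HB.instance Definition _ := Lmodule_isStarAlgebra.Build R A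
  fa_mulA fa_mulDl fa_mulDr fa_mulZl fa_mulZr fa_starK fa_starD fa_starZ
  fa_starM.

Definition sup_norm f : R := sup [set complex.Re `|f x| | x in [set: X]].

Lemma normcRe (z : R[i]) : ((complex.Re `|z|)%:C)%C = `|z|.
Proof. by rewrite RRe_real // realE normr_ge0. Qed.

Lemma normcRe_ge0 (z : R[i]) : 0 <= complex.Re `|z|.
Proof. by have := normr_ge0 z; rewrite lecE => /andP[]. Qed.

Lemma sup_norm_ub f x : `|f x| <= ((sup_norm f)%:C)%C.
Proof.
rewrite -normcRe lecR; apply: ub_le_sup; last by exists x.
have [M fM] := fcc_bounded closedP (fun_algP f).
by exists M => _ /= [y _ <-]; rewrite -lecR normcRe.
Qed.

Lemma sup_norm_le f (M : R) : 0 <= M ->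
  (forall x, `|f x| <= (M%:C)%C) -> sup_norm f <= M.
Proof.
move=> M0 fM.
have [E|/set0P[x0 _]] := eqVneq [set: X] set0.
  by rewrite /sup_norm E image_set0 sup0.
apply: ge_sup; first by exists (complex.Re `|f x0|); exists x0.
by move=> _ /= [y _ <-]; rewrite -lecR normcRe.
Qed.

Lemma sup_norm_ge0 f : 0 <= sup_norm f.
Proof.
have [E|/set0P[x0 _]] := eqVneq [set: X] set0.
  by rewrite /sup_norm E image_set0 sup0.
by rewrite -lecR; exact: le_trans (normr_ge0 (f x0)) (sup_norm_ub f x0).
Qed.

Definition fa_norm f : R[i] := ((sup_norm f)%:C)%C.

Fact fa_normD f g : fa_norm (f + g) <= fa_norm f + fa_norm g.
Proof.
rewrite /fa_norm -rmorphD lecR; apply: sup_norm_le.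
  by rewrite addr_ge0 // sup_norm_ge0.
move=> x; rewrite rmorphD /= (le_trans (ler_normD _ _)) //.
by apply: lerD; exact: sup_norm_ub.
Qed.

Let fa_normZ_le (c : R[i]) f : fa_norm (c *: f) <= `|c| * fa_norm f.
Proof.
rewrite /fa_norm -(normcRe c) -rmorphM lecR; apply: sup_norm_le.
  by rewrite mulr_ge0 ?sup_norm_ge0 // normcRe_ge0.
move=> x; rewrite rmorphM /= normcRe normrM.
by apply: ler_wpM2l => //; exact: sup_norm_ub.
Qed.

Fact fa_norm0_eq0 f : fa_norm f = 0 -> f = 0.
Proof.
move=> f0; apply: fun_alg_eq => x /=; apply/eqP; rewrite -normr_le0.
by rewrite -[leRHS]f0; exact: sup_norm_ub.
Qed.

Fact fa_normZ (c : R[i]) f : fa_norm (c *: f) = `|c| * fa_norm f.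
Proof.
apply/le_anti; rewrite fa_normZ_le /=.
have [->|c0] := eqVneq c 0.
  by rewrite normr0 mul0r /fa_norm lecR sup_norm_ge0.
rewrite -ler_pdivlMl ?normr_gt0 // -normfV.
by rewrite (le_trans _ (fa_normZ_le _ _)) // scalerA mulVf // scale1r.
Qed.

HB.instance Definition _ := Lmodule_isNormed.Build R[i] A
  fa_normD fa_normZ fa_norm0_eq0.

Lemma fun_alg_normE f : `|f| = ((sup_norm f)%:C)%C. Proof. by []. Qed.

Lemma fun_alg_norm_ub f x : `|f x| <= `|f|.
Proof. exact: sup_norm_ub. Qed.

Lemma fun_alg_norm_le f (M : R) : 0 <= M ->
  (forall x, `|f x| <= (M%:C)%C) -> `|f| <= (M%:C)%C.
Proof. by move=> M0 fM; rewrite fun_alg_normE lecR; exact: sup_norm_le. Qed.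

Fact fun_alg_complete (F : set_system A) : ProperFilter F -> cauchy F -> cvg F.
Proof.
move=> FF Fc.
have lP x : exists l : R[i]^o, (fun f : A => f x : R[i]^o) @ F --> l.
  apply/cvg_ex.
  apply: (@complex_complete R ((fun f : A => f x : R[i]^o) @ F)).
  apply/cauchy_ballP => e e0.
  move/cauchy_ballP : Fc => /(_ e e0) [[U V] /= [FU FV] UV].
  exists ((fun f : A => f x : R[i]^o) @` U, (fun f : A => f x : R[i]^o) @` V).
    by split; [apply: filterS FU|apply: filterS FV] => f ? /=; exists f.
  move=> [_ _] /= [[f Uf <-] [g Vg <-]].
  have := UV (f, g) (conj Uf Vg); rewrite /= -!ball_normE /= => fg.
  exact: le_lt_trans (fun_alg_norm_ub (f - g) x) fg.
have /choice[l Fl] := lP.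
have Fcl (e : R) : 0 < e ->
    F [set f : A | forall x, `|l x - f x| < (e%:C)%C].
  move=> e0.
  have e20 : 0 < ((e / 2)%:C)%C :> R[i] by rewrite ltcR divr_gt0.
  move/cauchy_ballP : (Fc) => /(_ _ e20) [[U V] /= [FU FV] UV].
  near=> f => x /=.
  have Vf : V f by near: f.
  move/cvgrPdist_lt : (Fl x) => /(_ _ e20) Flx.
  have /filter_ex[g /= [Ug lg]] : F [set g | U g /\ `|l x - g x| < ((e / 2)%:C)%C].
    exact: filterI.
  have := UV (g, f) (conj Ug Vf); rewrite /= -!ball_normE /= => gf.
  rewrite (splitr e) rmorphD /= -(subrKA (g x : R[i])).
  rewrite (le_lt_trans (ler_normD _ _)) // ltrD //.
  exact: le_lt_trans (fun_alg_norm_ub (g - f) x) gf.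
have Pl : fun_cstar_set P l.
  apply: (fcc_limit closedP) => e e0.
  by have /filter_ex[f lf] := Fcl e e0; exists f => //; exact: fun_algP.
apply/cvg_ex; exists (FunAlg Pl : A); apply/cvgrPdist_lt => e.
move=> /complex_gt0P[r r0 ->].
have r20 : 0 < r / 2 by rewrite divr_gt0.
near=> f.
have lf : forall x, `|l x - (f x : R[i]^o)| < ((r / 2)%:C)%C.
  by near: f; exact: Fcl.
apply: (@le_lt_trans _ _ ((r / 2)%:C)%C).
  apply: fun_alg_norm_le; first exact: ltW.
  by move=> x; apply: ltW; exact: lf.
by rewrite ltcR ltr_pdivrMr // ltr_pMr // ltr1n.
Unshelve. all: by end_near. Qed.

HB.instance Definition _ := Uniform_isComplete.Build A fun_alg_complete.

Fact fun_alg_normM f g : `|smul f g| <= `|f| * `|g|.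
Proof.
rewrite !fun_alg_normE -rmorphM; apply: fun_alg_norm_le.
  by rewrite mulr_ge0 // sup_norm_ge0.
move=> x; rewrite rmorphM /= normrM.
by apply: ler_pM => //; exact: sup_norm_ub.
Qed.

Fact fun_alg_norm_star f : `|smul (star f) f| = `|f| ^+ 2.
Proof.
apply/le_anti/andP; split.
  rewrite !fun_alg_normE -rmorphXn; apply: fun_alg_norm_le.
    by rewrite exprn_ge0 // sup_norm_ge0.
  move=> x; rewrite rmorphXn /= normrM norm_conjC -expr2.
  rewrite ler_pXn2r ?nnegrE ?normr_ge0 ?ler0c ?sup_norm_ge0 //.
  exact: sup_norm_ub.
have s0 : 0 <= sup_norm (smul (star f) f) by exact: sup_norm_ge0.
rewrite !fun_alg_normE -rmorphXn lecR -[leRHS]sqr_sqrtr //.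
rewrite ler_pXn2r ?nnegrE ?sqrtr_ge0 ?sup_norm_ge0 //.
apply: sup_norm_le; first exact: sqrtr_ge0.
move=> x; rewrite -(@ler_pXn2r _ 2) ?nnegrE //; last first.
  by rewrite ler0c sqrtr_ge0.
rewrite -[leRHS]rmorphXn /= sqr_sqrtr //.
have := sup_norm_ub (smul (star f) f) x.
by rewrite /= normrM norm_conjC -expr2.
Qed.

HB.instance Definition _ := isCStarAlgebra.Build R A
  fun_alg_normM fun_alg_norm_star.

End fun_alg_theory.

Section prod_star_algebra.
Variables (R : realType) (A B : starAlgType R).
Implicit Types u v w : A * B.

Definition prod_smul u v : A * B := (smul u.1 v.1, smul u.2 v.2).
Definition prod_star u : A * B := (star u.1, star u.2).

Fact prod_smulA : associative prod_smul.
Proof. by move=> u v w; rewrite /prod_smul /= !smulA. Qed.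
Fact prod_smulDl : left_distributive prod_smul +%R.
Proof. by move=> u v w; rewrite /prod_smul /= !smulDl. Qed.
Fact prod_smulDr : right_distributive prod_smul +%R.
Proof. by move=> u v w; rewrite /prod_smul /= !smulDr. Qed.
Fact prod_smulZl (c : R[i]) u v : prod_smul (c *: u) v = c *: prod_smul u v.
Proof. by rewrite /prod_smul /= !smulZl. Qed.
Fact prod_smulZr (c : R[i]) u v : prod_smul u (c *: v) = c *: prod_smul u v.
Proof. by rewrite /prod_smul /= !smulZr. Qed.
Fact prod_starK : involutive prod_star.
Proof. by move=> [a b]; rewrite /prod_star /= !starK. Qed.
Fact prod_starD : {morph prod_star : u v / u + v}.
Proof. by move=> u v; rewrite /prod_star /= !starD. Qed.
Fact prod_starZ (c : R[i]) u : prod_star (c *: u) = Num.conj c *: prod_star u.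
Proof. by rewrite /prod_star /= !starZ. Qed.
Fact prod_starM u v :
  prod_star (prod_smul u v) = prod_smul (prod_star v) (prod_star u).
Proof. by rewrite /prod_star /= !starM. Qed.

HB.instance Definition _ := Lmodule_isStarAlgebra.Build R (A * B)%type
  prod_smulA prod_smulDl prod_smulDr prod_smulZl prod_smulZr prod_starK
  prod_starD prod_starZ prod_starM.

End prod_star_algebra.

Definition star_hom (R : realType) (A B : starAlgType R) (f : A -> B) : Prop :=
  [/\ linear f,
      forall a b, f (smul a b) = smul (f a) (f b) &
      forall a, f (star a) = star (f a)].

Section multiplier_def.
Variables (R : realType) (B : cstarAlgType R).
Implicit Types a b x y : B.

(* The multiplier algebra, as the algebra of adjointable operators on [B] *)
(* viewed as a right Hilbert [B]-module with inner product [a^* b].  Such *)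
(* operators are automatically linear, [B]-linear and bounded. *)
Record multiplier := Multiplier {
  mult_fun :> B -> B ;
  mult_adj : B -> B ;
  multP : forall a b,
    smul (star (mult_fun a)) b = smul (star a) (mult_adj b)
}.

Implicit Types S T U : multiplier.

HB.instance Definition _ := gen_eqMixin multiplier.
HB.instance Definition _ := gen_choiceMixin multiplier.

Lemma smul0r a : smul a 0 = 0.
Proof. by rewrite -(scale0r 0) smulZr !scale0r. Qed.

Lemma smul0l a : smul 0 a = 0.
Proof. by rewrite -(scale0r 0) smulZl !scale0r. Qed.

Lemma star0 : star (0 : B) = 0.
Proof. by rewrite -(scale0r 0) starZ rmorph0 !scale0r. Qed.

Lemma smulNr a b : smul a (- b) = - smul a b.
Proof. by rewrite -scaleN1r smulZr scaleN1r. Qed.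

Lemma smulBr a b c : smul a (b - c) = smul a b - smul a c.
Proof. by rewrite smulDr smulNr. Qed.

Lemma smulBl a b c : smul (a - b) c = smul a c - smul b c.
Proof. by rewrite smulDl -scaleN1r smulZl scaleN1r. Qed.

Lemma star_smul_inj x y :
  (forall a, smul (star a) x = smul (star a) y) -> x = y.
Proof.
move=> xy; apply/eqP; rewrite -subr_eq0 -normr_eq0 -sqrf_eq0.
by rewrite -normr_star_smul smulBr xy subrr normr0.
Qed.

Lemma multPr T a b : smul (star a) (T b) = smul (star (mult_adj T a)) b.
Proof. by rewrite -[LHS]starK starM starK multP starM !starK. Qed.

Lemma multiplier_eq S T : (forall b, S b = T b) -> S = T.
Proof.
case: S T => [f f' fP] [g g' gP] /= fg.
have {}fg : f = g by apply/funext.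
have fg' : f' = g'.
  by apply/funext => b; apply: star_smul_inj => a; rewrite -fP -gP fg.
by rewrite fg fg' in fP gP *; congr Multiplier; exact: Prop_irrelevance.
Qed.

Lemma multD T a b : T (a + b) = T a + T b.
Proof. by apply: star_smul_inj => c; rewrite multPr !smulDr !multPr. Qed.

Lemma multZ T (c : R[i]) b : T (c *: b) = c *: T b.
Proof. by apply: star_smul_inj => a; rewrite multPr !smulZr multPr. Qed.


Fact mult0P a b : smul (star 0) b = smul (star a) 0.
Proof. by rewrite star0 smul0l smul0r. Qed.
Definition mult0 : multiplier := Multiplier mult0P.

Fact multDP S T a b :
  smul (star (S a + T a)) b = smul (star a) (mult_adj S b + mult_adj T b).
Proof. by rewrite starD smulDl smulDr !multP. Qed.
Definition mult_add S T : multiplier := Multiplier (multDP S T).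

Fact multZP (c : R[i]) T a b :
  smul (star (c *: T a)) b = smul (star a) (Num.conj c *: mult_adj T b).
Proof. by rewrite starZ smulZl smulZr multP. Qed.
Definition mult_scale (c : R[i]) T : multiplier := Multiplier (multZP c T).

Definition mult_opp T : multiplier := mult_scale (- 1) T.

Fact multMP S T a b :
  smul (star (S (T a))) b = smul (star a) (mult_adj T (mult_adj S b)).
Proof. by rewrite !multP. Qed.
Definition mult_mul S T : multiplier := Multiplier (multMP S T).

Fact multJP T a b : smul (star (mult_adj T a)) b = smul (star a) (T b).
Proof. by rewrite multPr. Qed.
Definition mult_star T : multiplier := Multiplier (multJP T).

Fact mult_addA : associative mult_add.
Proof. by move=> S T U; apply: multiplier_eq => b /=; rewrite addrA. Qed.
Fact mult_addC : commutative mult_add.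
Proof. by move=> S T; apply: multiplier_eq => b /=; rewrite addrC. Qed.
Fact mult_add0 : left_id mult0 mult_add.
Proof. by move=> T; apply: multiplier_eq => b /=; rewrite add0r. Qed.
Fact mult_addN : left_inverse mult0 mult_opp mult_add.
Proof. by move=> T; apply: multiplier_eq => b /=; rewrite scaleN1r addNr. Qed.

HB.instance Definition _ :=
  GRing.isZmodule.Build multiplier mult_addA mult_addC mult_add0 mult_addN.

Fact mult_scaleA (c d : R[i]) T :
  mult_scale c (mult_scale d T) = mult_scale (c * d) T.
Proof. by apply: multiplier_eq => b /=; rewrite scalerA. Qed.
Fact mult_scale1 : left_id 1 mult_scale.
Proof. by move=> T; apply: multiplier_eq => b /=; rewrite scale1r. Qed.
Fact mult_scaleDr : right_distributive mult_scale +%R.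
Proof. by move=> c S T; apply: multiplier_eq => b /=; rewrite scalerDr. Qed.
Fact mult_scaleDl T : {morph mult_scale^~ T : c d / c + d}.
Proof. by move=> c d; apply: multiplier_eq => b /=; rewrite scalerDl. Qed.

HB.instance Definition _ := GRing.Zmodule_isLmodule.Build R[i] multiplier
  mult_scaleA mult_scale1 mult_scaleDr mult_scaleDl.

Fact mult_mulA : associative mult_mul.
Proof. by move=> S T U; apply: multiplier_eq. Qed.
Fact mult_mulDl : left_distributive mult_mul +%R.
Proof. by move=> S T U; apply: multiplier_eq. Qed.
Fact mult_mulDr : right_distributive mult_mul +%R.
Proof. by move=> S T U; apply: multiplier_eq => b /=; rewrite multD. Qed.
Fact mult_mulZl (c : R[i]) S T : mult_mul (c *: S) T = c *: mult_mul S T.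
Proof. by apply: multiplier_eq. Qed.
Fact mult_mulZr (c : R[i]) S T : mult_mul S (c *: T) = c *: mult_mul S T.
Proof. by apply: multiplier_eq => b /=; rewrite multZ. Qed.
Fact mult_starK : involutive mult_star.
Proof. by move=> T; apply: multiplier_eq. Qed.
Fact mult_starD : {morph mult_star : S T / S + T}.
Proof. by move=> S T; apply: multiplier_eq. Qed.
Fact mult_starZ (c : R[i]) T :
  mult_star (c *: T) = Num.conj c *: mult_star T.
Proof. by apply: multiplier_eq. Qed.
Fact mult_starM S T :
  mult_star (mult_mul S T) = mult_mul (mult_star T) (mult_star S).
Proof. by apply: multiplier_eq. Qed.

HB.instance Definition _ := Lmodule_isStarAlgebra.Build R multiplier
  mult_mulA mult_mulDl mult_mulDr mult_mulZl mult_mulZr mult_starK mult_starD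
  mult_starZ mult_starM.

Fact mult_ofP x a b :
  smul (star (smul x a)) b = smul (star a) (smul (star x) b).
Proof. by rewrite starM smulA. Qed.

Definition mult_of x : multiplier := Multiplier (mult_ofP x).

Lemma mult_ofD x y : mult_of (x + y) = mult_of x + mult_of y.
Proof. by apply: multiplier_eq => b /=; rewrite smulDl. Qed.

Lemma mult_ofZ (c : R[i]) x : mult_of (c *: x) = c *: mult_of x.
Proof. by apply: multiplier_eq => b /=; rewrite smulZl. Qed.

Lemma mult_ofN x : mult_of (- x) = - mult_of x.
Proof. by rewrite -scaleN1r mult_ofZ scaleN1r. Qed.

Lemma mult_of0 : mult_of 0 = 0.
Proof. by apply: multiplier_eq => b /=; rewrite smul0l. Qed.

Definition corona_eq S T : bool := `[< exists b, S - T = mult_of b >].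

Fact corona_eq_equiv : equiv_class_of corona_eq.
Proof.
split=> [T|S T|T S U].
- by apply/asboolP; exists 0; rewrite subrr mult_of0.
- apply/idP/idP => /asboolP[b e]; apply/asboolP; exists (- b);
    by rewrite -opprB e mult_ofN.
- move=> /asboolP[b e] /asboolP[c e']; apply/asboolP; exists (b + c).
  by rewrite mult_ofD -e -e' addrA subrK.
Qed.

Canonical corona_equiv := EquivRelPack corona_eq_equiv.

Definition corona : Type := {eq_quot corona_equiv}%qT.

Definition corona_pi T : corona := (\pi_({eq_quot corona_equiv}) T)%qT.

Lemma corona_piP S T :
  corona_pi S = corona_pi T <-> exists b, S - T = mult_of b.
Proof.
by split=> [/eqmodP/asboolP|ST]; last by apply/eqmodP/asboolP.
Qed.

End multiplier_def.

(* [Mor(A, B)]: nondegenerate *-homomorphisms from [A] to [M(B)].  No scalars *)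
(* are needed in the span since they can be absorbed by [A]. *)
Definition Mor (R : realType) (A B : cstarAlgType R)
    (phi : A -> multiplier B) : Prop :=
  star_hom phi /\
  dense [set y : B | exists s : seq (A * B),
    y = \sum_(p <- s) phi p.1 p.2].

Record extension (R : realType) (B E A : cstarAlgType R) := Extension {
  ext_inc : B -> E ;
  ext_quo : E -> A ;
  ext_inc_hom : star_hom ext_inc ;
  ext_quo_hom : star_hom ext_quo ;
  ext_inc_inj : injective ext_inc ;
  ext_quo_surj : forall a, exists e, ext_quo e = a ;
  ext_exact : forall e, ext_quo e = 0 <-> exists b, ext_inc b = e
}.

(* For a splitting [s], the map [ext_alpha ext \o s] defined below is a *)
(* *-homomorphism lifting the Busby invariant, but it can be degenerate: it is *)
(* zero for the direct sum extension of the complex numbers by the functions *)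
(* vanishing at infinity on the real line, split by [c |-> (0, c)].  That *)
(* direct sum has no unit, whereas the unified space of the line and a point *)
(* is a circle, so the extension does not come from a map of spaces.  For the *)
(* splittings that do, [ext_alpha ext \o s] belongs to [Mor]. *)
Definition splitting (R : realType) (B E A : cstarAlgType R)
    (ext : extension B E A) (s : A -> E) : Prop :=
  star_hom s /\ forall a, ext_quo ext (s a) = a.

Definition extension_iso (R : realType) (B E F A : cstarAlgType R)
    (ext : extension B E A) (ext' : extension B F A) (Phi : E -> F) : Prop :=
  [/\ star_hom Phi, bijective Phi,
      forall b, Phi (ext_inc ext b) = ext_inc ext' b &
      forall e, ext_quo ext' (Phi e) = ext_quo ext e].

Section busby.
Variables (R : realType) (B E A : cstarAlgType R) (ext : extension B E A).

Fact ext_ideal (e : E) (b : B) :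
  exists b', ext_inc ext b' = smul e (ext_inc ext b).
Proof.
apply/ext_exact; have [_ -> _] := ext_quo_hom ext.
by rewrite (ext_exact ext (ext_inc ext b)).2 ?smul0r //; exists b.
Qed.

Definition ext_act (e : E) (b : B) : B := projT1 (cid (ext_ideal e b)).

Lemma ext_actE (e : E) (b : B) :
  ext_inc ext (ext_act e b) = smul e (ext_inc ext b).
Proof. by rewrite /ext_act; case: cid. Qed.

Fact ext_actP (e : E) (a b : B) :
  smul (star (ext_act e a)) b = smul (star a) (ext_act (star e) b).
Proof.
apply: (@ext_inc_inj _ _ _ _ ext); have [_ iM iJ] := ext_inc_hom ext.
by rewrite !iM !iJ !ext_actE starM smulA.
Qed.

Definition ext_alpha (e : E) : multiplier B := Multiplier (ext_actP e).

Definition busby (a : A) : corona B :=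
  corona_pi (ext_alpha (projT1 (cid (ext_quo_surj ext a)))).

Lemma busbyE (e : E) : busby (ext_quo ext e) = corona_pi (ext_alpha e).
Proof.
rewrite /busby; case: cid => e' /= ee'.
apply/corona_piP; have [iL iM iJ] := ext_inc_hom ext; have [qL _ _] := ext_quo_hom ext.
have [b ib] : exists b, ext_inc ext b = e' - e.
  by apply/ext_exact; rewrite -scaleN1r addrC qL ee' scaleN1r addNr.
exists b; apply: multiplier_eq => c /=.
apply: (@ext_inc_inj _ _ _ _ ext).
by rewrite iM ib /= addrC iL !ext_actE scaleN1r addrC smulBl.
Qed.

Definition busby_lift (phi : A -> multiplier B) : Prop :=
  star_hom phi /\ forall a, corona_pi (phi a) = busby a.

End busby.

Section function_spaces.
Variables (R : realType) (X : topologicalType).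
Local Notation C := (R[i]^o).
Implicit Types f g : X -> C.

Definition bounded_function f : Prop :=
  exists M : R, forall x, `|f x| <= (M%:C)%C.

Definition vanishes_at_infinity f : Prop :=
  forall e : R, 0 < e -> exists2 K : set X, compact K &
    forall x, ~ K x -> `|f x| < (e%:C)%C.

Lemma continuous_limit f :
  (forall e : R, 0 < e ->
     exists2 g, continuous g & forall x, `|f x - g x| < (e%:C)%C) ->
  continuous f.
Proof.
move=> fg x; apply/cvgrPdist_lt => e /complex_gt0P[r r0 ->].
have r30 : 0 < r / 3 by rewrite divr_gt0.
have [g gc fge] := fg _ r30.
have r3C : 0 < ((r / 3)%:C)%C :> R[i] by rewrite ltcR.
have /cvgrPdist_lt /(_ _ r3C) := gc x.
apply: filterS => t gxt.
have -> : r = r / 3 + (r / 3 + r / 3) by field.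
rewrite -[f x - f t](subrKA (g x)) -[g x - f t](subrKA (g t)).
rewrite !rmorphD (le_lt_trans (ler_normD _ _)) // ltrD //.
by rewrite (le_lt_trans (ler_normD _ _)) // ltrD // distrC.
Qed.

Lemma continuous_conj f : continuous f -> continuous (fun x => Num.conj (f x) : C).
Proof.
move=> fc x; apply/cvgrPdist_lt => e e0.
have /cvgrPdist_lt /(_ _ e0) := fc x.
by apply: filterS => t; rewrite -rmorphB norm_conjC.
Qed.

Lemma bounded_functionZ (c : R[i]) f :
  bounded_function f -> bounded_function (fun x => c * f x).
Proof.
move=> [M fM]; exists (complex.Re `|c| * M) => x.
by rewrite rmorphM /= normcRe normrM ler_wpM2l.
Qed.

Lemma bounded_functionM f g : bounded_function f -> bounded_function g ->
  bounded_function (fun x => f x * g x).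
Proof.
move=> [M fM] [N gN]; exists (M * N) => x.
by rewrite rmorphM /= normrM ler_pM.
Qed.

Lemma vanishing_bounded f : continuous f -> vanishes_at_infinity f ->
  bounded_function f.
Proof.
move=> fc f0; have [K cK fK] := f0 1 ltr01.
pose g (x : X) : R := complex.Re `|f x|.
have gc : continuous g.
  move=> x; apply/cvgrPdist_lt => e e0.
  have eC : 0 < (e%:C)%C :> R[i] by rewrite ltcR.
  have /cvgrPdist_lt /(_ _ eC) := fc x; apply: filterS => t.
  rewrite /g -raddfB -ltcR; apply: le_lt_trans.
  exact: le_trans (normc_ge_Re _) (ler_dist_dist _ _).
have gK : compact (g @` K).
  by apply: continuous_compact => //; exact: continuous_subspaceT.
have [M [_ gM]] := compact_bounded gK.
exists (Num.max (M + 1) 1) => x; have [Kx|/fK/ltW fx] := pselect (K x).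
  rewrite -normcRe lecR (le_trans (ler_norm _)) //.
  by apply: gM; [rewrite lt_max ltrDl ltr01|exists x].
by rewrite (le_trans fx) // lecR le_max lexx orbT.
Qed.

Lemma vanishingMl f g : bounded_function f -> vanishes_at_infinity g ->
  vanishes_at_infinity (fun x => f x * g x).
Proof.
move=> [M fM] g0 e e0.
pose N : R := Num.max M 1.
have N0 : 0 < N by rewrite lt_max ltr01 orbT.
have [K cK gK] := g0 (e / N) (divr_gt0 e0 N0).
exists K => // x /gK gx; rewrite normrM.
apply: (@le_lt_trans _ _ ((N%:C)%C * `|g x|)).
  by rewrite ler_wpM2r // (le_trans (fM x)) // lecR le_max lexx.
rewrite -ltr_pdivlMl ?ltcR //; apply: (lt_le_trans gx).
by rewrite mulrC -fmorphV -rmorphM.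
Qed.

Definition Cb_set : set (X -> C) :=
  [set f | continuous f /\ bounded_function f].

Fact Cb_closed : fun_cstar_closed Cb_set.
Proof.
split.
- by move=> f [].
- split; first exact: cst_continuous.
  by exists 0 => x; rewrite normr0.
- move=> f g [fc [M fM]] [gc [N gN]]; split.
    by move=> x; exact: cvgD (fc x) (gc x).
  exists (M + N) => x; rewrite rmorphD (le_trans (ler_normD _ _)) //.
  exact: lerD.
- move=> c f [fc fb]; split; last exact: bounded_functionZ.
  by move=> x; apply: cvgM (fc x); exact: cvg_cst.
- move=> f g [fc fb] [gc gb]; split; last exact: bounded_functionM.
  by move=> x; exact: cvgM (fc x) (gc x).
- move=> f [fc [M fM]]; split; first exact: continuous_conj.
  by exists M => x; rewrite norm_conjC.
- move=> f fg; split.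
    by apply: continuous_limit => e /fg[g [gc _]]; exists g.
  have [g [_ [M gM]] fg1] := fg 1 ltr01; exists (1 + M) => x.
  rewrite -[f x](subrK (g x)) rmorphD (le_trans (ler_normD _ _)) //.
  by rewrite lerD // ltW.
Qed.

Definition C0_set : set (X -> C) :=
  [set f | continuous f /\ vanishes_at_infinity f].

Fact C0_closed : fun_cstar_closed C0_set.
Proof.
split.
- by move=> f [fc f0]; exact: vanishing_bounded.
- split; first exact: cst_continuous.
  move=> e e0; exists set0; first exact: compact0.
  by move=> x _; rewrite normr0 ltcR.
- move=> f g [fc f0] [gc g0]; split.
    by move=> x; exact: cvgD (fc x) (gc x).
  move=> e e0; have e20 : 0 < e / 2 by rewrite divr_gt0.
  have [K cK fK] := f0 _ e20; have [L cL gL] := g0 _ e20.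
  exists (K `|` L); first exact: compactU.
  move=> x /not_orP[/fK fx /gL gx].
  by rewrite (splitr e) rmorphD (le_lt_trans (ler_normD _ _)) // ltrD.
- move=> c f [fc f0]; split.
    by move=> x; apply: cvgM (fc x); exact: cvg_cst.
  apply: vanishingMl => //; exists (complex.Re `|c|) => x.
  by rewrite normcRe.
- move=> f g [fc f0] [gc g0]; split.
    by move=> x; exact: cvgM (fc x) (gc x).
  by apply: vanishingMl => //; exact: vanishing_bounded.
- move=> f [fc f0]; split; first exact: continuous_conj.
  move=> e /f0[K cK fK]; exists K => // x /fK.
  by rewrite norm_conjC.
- move=> f fg; split.
    by apply: continuous_limit => e /fg[g [gc _]]; exists g.
  move=> e e0; have e20 : 0 < e / 2 by rewrite divr_gt0.
  have [g [_ g0] fge] := fg _ e20; have [K cK gK] := g0 _ e20.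
  exists K => // x /gK gx; rewrite -[f x](subrK (g x)) (splitr e) rmorphD.
  by rewrite (le_lt_trans (ler_normD _ _)) // ltrD.
Qed.

End function_spaces.

Definition Cb (R : realType) (X : topologicalType) : Type :=
  fun_alg (FunCStar (Cb_closed R X)).

HB.instance Definition _ R X := CStarAlgebra.on (Cb R X).

Definition C0 (R : realType) (X : topologicalType) : Type :=
  fun_alg (FunCStar (C0_closed R X)).

HB.instance Definition _ R X := CStarAlgebra.on (C0 R X).

Section Cb_multiplier.
Variables (R : realType) (X : topologicalType).

Lemma C0_in_Cb (b : C0 R X) : Cb_set (b : X -> R[i]^o).
Proof.
by have [bc b0] := fun_algP b; split=> //; exact: vanishing_bounded.
Qed.

Definition Cb_of_C0 (b : C0 R X) : Cb R X :=
  @FunAlg R X (FunCStar (Cb_closed R X)) _ (C0_in_Cb b).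

Fact Cb_mulP (g : Cb R X) (b : C0 R X) : C0_set (fun x => g x * b x : R[i]^o).
Proof.
have [gc gb] := fun_algP g; have [bc b0] := fun_algP b; split.
  by move=> x; exact: cvgM (gc x) (bc x).
exact: vanishingMl.
Qed.

Definition Cb_mul (g : Cb R X) (b : C0 R X) : C0 R X :=
  @FunAlg R X (FunCStar (C0_closed R X)) _ (Cb_mulP g b).

Fact Cb_mult_subproof (g : Cb R X) (a b : C0 R X) :
  smul (star (Cb_mul g a)) b = smul (star a) (Cb_mul (star g) b).
Proof. by apply: fun_alg_eq => x /=; rewrite rmorphM mulrA (mulrC (Num.conj _)). Qed.

(* The identification of [C_b(X)] with the multiplier algebra of [C_0(X)]. *)
Definition Cb_mult (g : Cb R X) : multiplier (C0 R X) :=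
  Multiplier (Cb_mult_subproof g).

End Cb_multiplier.

Section pullback.
Variables (R : realType) (X Y : topologicalType) (f : X -> Y).
Hypothesis cf : continuous f.

Fact pullbackP (h : C0 R Y) : Cb_set (h \o f : X -> R[i]^o).
Proof.
have [hc [M hM]] := C0_in_Cb h; split; last by exists M => x; exact: hM.
by move=> x; apply: continuous_comp; [exact: cf|exact: hc].
Qed.

Definition pullback (h : C0 R Y) : Cb R X :=
  @FunAlg R X (FunCStar (Cb_closed R X)) _ (pullbackP h).

End pullback.

(* [hX] and [cf] are needed for [unified_base] below to be a base. *)
Definition unified (X Y : topologicalType) (hX : hausdorff_space X)
  (f : X -> Y) (cf : continuous f) : Type := (X + Y)%type.

Section unified_space.
Variables (X Y : topologicalType) (hX : hausdorff_space X).
Variables (f : X -> Y) (cf : continuous f).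

Local Notation unified := (unified hX cf).

HB.instance Definition _ := Choice.copy unified (X + Y)%type.

Definition unified_map (z : unified) : Y :=
  match z with inl x => f x | inr y => y end.

Definition unified_base : set (set unified) :=
  [set W | (exists2 U : set X, open U & W = (inl : X -> unified) @` U) \/
    (exists V K, [/\ open V, compact K &
       W = unified_map @^-1` V `&` ~` ((inl : X -> unified) @` K)])].

Fact unified_cover : \bigcup_(W in unified_base) (id W) = setT.
Proof.
apply/seteqP; split=> // z _; exists setT => //; right.
exists setT, set0; split; [exact: openT|exact: compact0|].
by rewrite image_set0 setC0 setIT preimage_setT.
Qed.

Fact unified_join (W1 W2 : set unified) z :
  unified_base W1 -> unified_base W2 -> W1 z -> W2 z ->
  exists W, [/\ unified_base W, W z & W `<=` W1 `&` W2].
Proof.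
have mixed (U : set X) V (K : set X) :
    open U -> open V -> compact K -> open (U `&` f @^-1` V `&` ~` K).
  move=> oU oV cK; apply: openI.
    by apply: openI => //; exact: open_comp.
  by apply: closed_openC; exact: compact_closed.
move=> [[U oU ->]|[V [K [oV cK ->]]]] [[U' oU' ->]|[V' [K' [oV' cK' ->]]]].
- move=> [x Ux <-] [y U'y] [yx]; rewrite yx in U'y.
  exists (inl @` (U `&` U')); split; [|by exists x|].
    by left; exists (U `&` U') => //; exact: openI.
  by move=> _ [t [Ut U't] <-]; split; exists t.
- move=> [x Ux <-] [/= V'x K'x].
  exists (inl @` (U `&` f @^-1` V' `&` ~` K')); split.
  + by left; exists (U `&` f @^-1` V' `&` ~` K') => //; exact: mixed.
  + by exists x => //; split=> // K'x'; apply: K'x; exists x.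
  + move=> _ [t [[Ut V't] K't] <-]; split; first by exists t.
    by split=> // -[t' K't' [tt']]; apply: K't; rewrite -tt'.
- move=> [/= Vz Kz] [x U'x xz]; rewrite -xz in Vz Kz *.
  exists (inl @` (U' `&` f @^-1` V `&` ~` K)); split.
  + by left; exists (U' `&` f @^-1` V `&` ~` K) => //; exact: mixed.
  + by exists x => //; split=> // Kx; apply: Kz; exists x.
  + move=> _ [t [[Ut Vt] Kt] <-]; split; last by exists t.
    by split=> // -[t' Kt' [tt']]; apply: Kt; rewrite -tt'.
- move=> [/= Vz Kz] [/= V'z K'z].
  exists (unified_map @^-1` (V `&` V') `&` ~` (inl @` (K `|` K'))); split.
  + right; exists (V `&` V'), (K `|` K').
    by split; [exact: openI|exact: compactU|].
  + by split=> // -[x [Kx|K'x] xz]; [apply: Kz|apply: K'z]; exists x.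
  + move=> t [[Vt V't] KK't]; split; split=> // -[x Kx xt]; apply: KK't.
      by exists x => //; left.
    by exists x => //; right.
Qed.

HB.instance Definition _ :=
  isBaseTopological.Build unified unified_cover unified_join.

End unified_space.

Section unified_extension.
Variables (R : realType) (X Y : topologicalType) (hX : hausdorff_space X).
Variables (f : X -> Y) (cf : continuous f).

Definition unified_extension
    (ext : extension (C0 R X) (C0 R (unified hX cf)) (C0 R Y)) : Prop :=
  [/\ forall b x, ext_inc ext b (inl x) = b x,
      forall b y, ext_inc ext b (inr y) = 0 &
      forall k y, ext_quo ext k y = k (inr y)].

Definition unified_pullback : set (Cb R X * C0 R Y) :=
  [set gh | exists b : C0 R X, gh.1 - pullback cf gh.2 = Cb_of_C0 b].

End unified_extension.

(* Main.v *)
Require Import Defs.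
From mathcomp Require Import all_boot all_order all_algebra.
From mathcomp Require Import all_classical all_reals all_analysis.
From mathcomp Require Import complex ring.

Set Implicit Arguments.
Unset Strict Implicit.
Unset Printing Implicit Defensive.

Import Order.TTheory GRing.Theory Num.Theory.
Import numFieldNormedType.Exports.

Local Open Scope classical_set_scope.
Local Open Scope ring_scope.

(** Why the theorem holds.

  The open part [X] and the closed part [Y] of the unified space give the
  extension: a function in [C_0(X)] extends by zero, and a function vanishing
  on [Y] comes from [C_0(X)].  The latter holds because the places where it is
  not small form a compact set inside the open subset [X]
  ([unified_inl_compact]).  Composition with [unified_map] splits the
  restriction to [Y] since [unified_map] is proper ([unified_map_proper]): an
  ultrafilter that lies over a compact set of [Y] and avoids every compact set
  of [X] converges to a point of [Y].  For [b] supported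
  on [X], multiplying by [h \o unified_map] is multiplying by [h \o f], so the
  splitting acts on the ideal through [pullback cf]; this yields the lift of
  the Busby invariant.  The pair formed by the restrictions to [X] and to [Y]
  determines a function, and the pairs that occur are read off from the
  decomposition [k = b + unified_split h].

  Conversely, let [s] split an extension so that [phi h], the action of [s h]
  on the ideal, is nondegenerate.  A split extension is determined by this
  action ([split_extension_iso]), because the product of [b + s a] and
  [c + s d] only involves products in the ideal, products in the quotient and
  the action.  It remains to show that [phi] is the pullback along some
  continuous map ([Mor_pullback]).  A multiplier of [C_0(X)] acts as pointwise
  multiplication by a function ([multiplier_C0]), so [phi] followed by the
  value of that function at [x] is a character of [C_0(Y)]; nondegeneracy
  makes it nonzero.  A nonzero character is evaluation at a point
  ([character_eval]), and this point is [f x].  Continuity of [f] follows from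
  Urysohn functions: near [x] the function [phi h b] stays nonzero, hence so
  does [h \o f].

  That characters are evaluations is proved without spectral theory or
  boundedness of characters.  If [chi u = 1] then [u] takes the value [1], for
  otherwise [v = u / (1 - u)] lies in [C_0(Y)] and [v - u v = u] gives
  [chi u = 0].  Compactness of a set containing [g = 1], where [chi g = 1],
  then provides a common zero of the kernel of [chi]. *)

(** * Urysohn functions and characters of C_0(Y) *)

Section C0_functions.
Variables (R : realType) (Y : topologicalType).
Local Notation C := (R[i]^o).

Definition mkC0 (f : Y -> C) (Pf : C0_set f) : C0 R Y :=
  @FunAlg R Y (FunCStar (C0_closed R Y)) f Pf.

(** The one-point compactification is normal, and a Urysohn function that
  vanishes off [V] there vanishes at the point at infinity. *)
Lemma C0_urysohn (hY : hausdorff_space Y) (lY : locally_compact [set: Y])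
    (K V : set Y) : compact K -> open V -> K `<=` V ->
  exists h : C0 R Y, [/\ forall y, 0 <= h y <= 1, forall y, K y -> h y = 1 &
    forall y, ~ V y -> h y = 0].
Proof.
move=> cK oV KV; pose opc := one_point_compactification Y.
have hopc : hausdorff_space opc.
  exact: one_point_compactification_hausdorff.
have nopc : normal_space opc.
  exact: compact_normal hopc one_point_compactification_compact.
have clB : closed (Some @` K : set opc).
  apply: compact_closed => //; apply: continuous_compact => //.
  apply: continuous_subspaceT.
  exact: one_point_compactification_some_continuous.
have clA : closed (~` (Some @` V) : set opc).
  by apply: open_closedC; exact: one_point_compactification_open_some.
have AB0 : ~` (Some @` V) `&` (Some @` K : set opc) = set0.
  by apply/disjoints_subset/subsetC => _ [y /KV Vy <-]; exists y.
have := normal_uniform_separator nopc clA clB AB0.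
move=> /(@uniform_separatorP _ R)[g [gc g01 gA gB]].
have g0 : g None = 0.
  by apply: gA; exists None => // -[].
have hP : C0_set (fun y => ((g (Some y))%:C)%C : C).
  split.
    move=> y; apply/cvgrPdist_lt => e /complex_gt0P[r r0 ->].
    have /cvgrPdist_lt /(_ _ r0) gyr := gc (Some y).
    have : \forall t \near y, `|g (Some y) - g (Some t)| < r := gyr.
    by apply: filterS => t /=; rewrite -raddfB normc_real ltcR.
  move=> e e0; have /cvgrPdist_lt /(_ _ e0) := gc None.
  move=> [U [cU _] UW]; exists U => // y Uy; rewrite normc_real ltcR.
  have /= := UW (Some y); rewrite g0 sub0r normrN; apply.
  by left; exists y.
exists (mkC0 hP); split=> y /=.
- have := g01 (g (Some y)); rewrite /= in_itv /= => /(_ _)/andP[|a b].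
    by exists (Some y).
  by rewrite lecR lecR a.
- by move=> Ky; rewrite (gB (g (Some y))) //; exists (Some y) => //; exists y.
- move=> Vy; rewrite (gA (g (Some y))) //; exists (Some y) => //.
  by move=> [z Vz [zy]]; apply: Vy; rewrite -zy.
Qed.

End C0_functions.

Section characters.
Variables (R : realType) (Y : topologicalType).
Local Notation C := (R[i]^o).
Variable chi : C0 R Y -> R[i].
Hypothesis chiL : forall (a : R[i]) u v, chi (a *: u + v) = a * chi u + chi v.
Hypothesis chiM : forall u v, chi (smul u v) = chi u * chi v.
Hypothesis chiJ : forall u, chi (star u) = Num.conj (chi u).

Let chiB u v : chi (u - v) = chi u - chi v.
Proof. by rewrite -scaleN1r addrC chiL mulN1r addrC. Qed.

Let chiD u v : chi (u + v) = chi u + chi v.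
Proof. by rewrite -[u in LHS]scale1r chiL mul1r. Qed.

(** If [u] misses the value [1], then [u] has the quasi-inverse
  [v = u / (1 - u)] in [C_0(Y)], and [chi] maps [v - u v = u] to
  [chi v - chi v]. *)
Lemma character_value1 u : chi u = 1 -> exists y, u y = 1.
Proof.
move=> u1; apply: contrapT => /forallNP nu1.
have d0 y : 1 - u y != 0 by rewrite subr_eq0 eq_sym; exact/eqP.
have [uc u0] := fun_algP u.
have vP : C0_set (fun y => u y / (1 - u y) : C).
  split.
    move=> y; apply: cvgM; first exact: uc.
    by apply: cvgV => //; apply: cvgB; [exact: cvg_cst|exact: uc].
  (* Off K the denominator is at least 1 / 2, so that |v| <= 2 |u| < e. *)
  move=> e e0; have e20 : 0 < Num.min (1 / 2) (e / 2).
    by rewrite lt_min !divr_gt0.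
  have [K cK uK] := u0 _ e20; exists K => // y /uK uy.
  have {uy}[uy1 uy2] : `|u y| < ((1 / 2)%:C)%C /\ `|u y| < ((e / 2)%:C)%C.
    by split; apply: (lt_le_trans uy); rewrite lecR ge_min lexx ?orbT.
  have d2 : ((1 / 2)%:C)%C <= `|1 - u y|.
    have : ((1 - 1 / 2)%:C)%C <= `|1 - u y|.
      rewrite rmorphB /= rmorph1 (le_trans _ (lerB_dist _ _)) // normr1.
      by rewrite lerB // ltW.
    by rewrite (_ : 1 - 1 / 2 = 1 / 2 :> R) //; field.
  rewrite normrM normfV ltr_pdivrMr ?normr_gt0 //.
  apply: (lt_le_trans uy2); apply: le_trans (ler_wpM2l _ d2); last first.
    by rewrite ler0c ltW.
  by rewrite -rmorphM mulrA mulr1.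
have e : mkC0 vP - smul u (mkC0 vP) = u.
  apply: fun_alg_eq => y /=.
  by rewrite -[X in X - _]mul1r -mulrBl mulrCA mulfV ?mulr1.
have := congr1 chi e; rewrite chiB chiM u1 mul1r subrr.
by move=> /esym/eqP; rewrite oner_eq0.
Qed.

(** The function [u = 1 - |1 - g|^2 - |H|^2] lies in [C_0(Y)] and [chi u = 1];
  it takes the value [1] exactly where [g = 1] and [H = 0]. *)
Lemma character_common g H : chi g = 1 -> chi H = 0 ->
  exists2 y, g y = 1 & H y = 0.
Proof.
move=> g1 H0.
have [] := @character_value1 (g + star g - smul (star g) g - smul (star H) H).
  by rewrite !chiB chiD !chiM !chiJ g1 H0 rmorph1 mulr0 subr0 mulr1 addrK.
move=> y /= uy.
have key (a b : R[i]) : a + Num.conj a - Num.conj a * a - Num.conj b * b = 1 ->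
    a = 1 /\ b = 0.
  move=> ab; have : `|1 - a| ^+ 2 + `|b| ^+ 2 = 0.
    rewrite !normCKC rmorphB rmorph1 -(subrr (1 : R[i])) -[X in _ = _ - X]ab.
    by ring.
  move/eqP; rewrite paddr_eq0 ?exprn_ge0 // !sqrf_eq0 !normr_eq0 subr_eq0.
  by move=> /andP[/eqP <- /eqP].
by have [gy Hy] := key _ _ uy; exists y.
Qed.

(** Normalize [g] by [chi g = 1].  The sets where [g = 1] and [H = 0], for [H]
  in the kernel of [chi], form a filter base: they are nonempty by
  [character_common], and [|H|^2 + |L|^2] handles intersections.  They lie in
  a compact set, so they cluster at some [y].  There [g] is [1] and the kernel
  vanishes; apply this to [h - chi h *: g]. *)
Lemma character_eval : (exists g, chi g != 0) -> exists y, forall h, chi h = h y.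
Proof.
move=> [g0 g0n].
have chi0 : chi 0 = 0 by rewrite -(subrr g0) chiB subrr.
have chiZ a u : chi (a *: u) = a * chi u.
  by rewrite -[a *: u]addr0 chiL chi0 addr0.
have [g g1] : exists g, chi g = 1.
  by exists ((chi g0)^-1 *: g0); rewrite chiZ mulVf.
pose Z (H : C0 R Y) : set Y := [set y | g y = 1 /\ H y = 0].
pose F : set_system Y := [set A | exists2 H, chi H = 0 & Z H `<=` A].
have FF : ProperFilter F.
  split; last split.
  - by move=> [H /(character_common g1)[y gy Hy] /(_ y)]; exact.
  - by exists 0.
  - move=> A B [H H0 HA] [L L0 LB].
    exists (smul (star H) H + smul (star L) L).
      by rewrite chiD !chiM H0 L0 !mulr0 addr0.
    move=> y [gy /=]; rewrite -!normCKC => /eqP.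
    rewrite paddr_eq0 ?exprn_ge0 // !sqrf_eq0 !normr_eq0 => /andP[/eqP Hy /eqP Ly].
    by split; [apply: HA|apply: LB].
  - by move=> A B AB [H H0 HA]; exists H => //; exact: subset_trans AB.
have [gc gv] := fun_algP g; have [K cK gK] := gv 1 ltr01.
have FK : F K.
  exists 0 => // y [gy _]; apply: contrapT => /gK.
  by rewrite gy normr1 ltxx.
have [y [_ Fy]] := cK F FF FK; exists y.
have zero H : chi H = 0 -> H y = 0.
  move=> H0; apply: contrapT => /eqP Hy.
  have [Hc _] := fun_algP H.
  have ny : \forall t \near y, H t != 0 by apply: cvgr_neq0 (Hc y) _.
  have [t [[_ Ht] /=]] := Fy (Z H) _ (ex_intro2 _ _ H H0 (@subset_refl _ _)) ny.
  by rewrite Ht eqxx.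
have gy : g y = 1.
  apply: contrapT => /eqP; rewrite -subr_eq0 => gy1.
  have ny : \forall t \near y, g t - 1 != 0.
    by apply: cvgr_neq0 gy1; apply: cvgB; [exact: gc|exact: cvg_cst].
  have [t [[gt _] /=]] := Fy (Z 0) _ (ex_intro2 _ _ 0 chi0 (@subset_refl _ _)) ny.
  by rewrite gt subrr eqxx.
move=> h; have := zero (h - chi h *: g); rewrite chiB chiZ g1 mulr1 subrr.
by move=> /(_ erefl) /= /eqP; rewrite gy mulr1 subr_eq0 => /eqP.
Qed.

End characters.

(** * Topology of the unified space *)

Section unified_topology.
Variables (X Y : topologicalType) (hX : hausdorff_space X) (hY : hausdorff_space Y).
Variables (f : X -> Y) (cf : continuous f).
Local Notation U := (unified hX cf).
Local Notation fU := (@unified_map X Y hX f cf).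

Lemma unified_nbhsP (z : U) (A : set U) :
  nbhs z A <-> exists2 W, unified_base W & W z /\ W `<=` A.
Proof.
split.
  rewrite nbhsE => -[B [oB Bz] BA].
  have [D sD BE] : exists2 D, D `<=` @unified_base X Y hX f cf &
    \bigcup_(W in D) W = B := oB.
  move: Bz; rewrite -BE => -[W DW Wz].
  exists W; first exact: sD.
  by split=> // t Wt; apply: BA; rewrite -BE; exists W.
move=> [W bW [Wz WA]]; rewrite nbhsE; exists W => //; split => //.
by exists [set W]; [move=> _ ->|rewrite bigcup_set1].
Qed.

Lemma unified_inl_continuous : continuous (inl : X -> U).
Proof.
move=> x A /unified_nbhsP[W [[V oV ->]|[V [K [oV cK ->]]]] [Wx WA]].
  apply: (@filterS _ _ _ V); first by move=> t Vt; apply: WA; exists t.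
  by apply: open_nbhs_nbhs; split => //; case: Wx => t Vt [<-].
case: Wx => Vx Kx.
have oVK : open (f @^-1` V `&` ~` K).
  apply: openI; first exact: open_comp.
  by apply: closed_openC; exact: compact_closed.
apply: (@filterS _ _ _ (f @^-1` V `&` ~` K)); last first.
  by apply: open_nbhs_nbhs; split => //; split=> // Kx'; apply: Kx; exists x.
by move=> t [Vt Kt]; apply: WA; split=> // -[t' Kt' [tt']]; apply: Kt; rewrite -tt'.
Qed.

(** Clustering can be pulled back along [inl], since [inl] is open. *)
Lemma unified_inl_compact (S : set U) : compact S -> S `<=` range inl ->
  compact (inl @^-1` S : set X).
Proof.
move=> cS SX F FF FS.
have [z [Sz Fz]] := cS (inl @ F : set_system U) _ FS.
have [x _ xz] := SX _ Sz; subst z; exists x; split=> // A B FA Bx.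
have nB : nbhs (inl x : U) (inl @` B).
  move: Bx; rewrite nbhsE => -[V [oV Vx] VB]; apply/unified_nbhsP.
  exists (inl @` V); first by left; exists V.
  by split; [exists x|move=> _ [t /VB Bt <-]; exists t].
have FA' : (inl @ F : set_system U) (inl @` A).
  exact: (filterS (@preimage_image _ _ (inl : X -> U) A) FA).
have [_ [[t At <-] [t' Bt' [tt']]]] := Fz _ _ FA' nB.
by exists t; split=> //; rewrite -tt'.
Qed.

Lemma unified_inr_continuous : continuous (inr : Y -> U).
Proof.
move=> y A /unified_nbhsP[W [[V oV ->]|[V [K [oV cK ->]]]] [Wy WA]].
  by case: Wy.
case: Wy => /= Vy _.
apply: (@filterS _ _ _ V); last exact: open_nbhs_nbhs.
by move=> t Vt; apply: WA; split=> // -[].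
Qed.

Lemma unified_map_continuous : continuous fU.
Proof.
move=> z A; rewrite nbhsE => -[V [oV Vz] VA].
apply/unified_nbhsP; exists (fU @^-1` V).
  right; exists V, set0; split => //; first exact: compact0.
  by rewrite image_set0 setC0 setIT.
by split=> // t /VA.
Qed.

(** An ultrafilter over the preimage of [L] either contains a compact subset
  of [X], and converges there, or avoids all of them; in the second case its
  image clusters at some [y] in [L], and the neighbourhoods of [inr y] are
  preimages of neighbourhoods of [y] with compact subsets of [X] removed. *)
Lemma unified_map_proper (L : set Y) : compact L -> compact (fU @^-1` L).
Proof.
move=> cL; rewrite compact_ultra => F FU FL.
have clL : closed (fU @^-1` L).
  apply: preimage_closed; last exact: compact_closed.
  by move=> z _; exact: unified_map_continuous.
have [[K cK FK]|noK] := pselect (exists2 K : set X, compact K & F (inl @` K)).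
  have cKL : compact ((inl @` K : set U) `&` fU @^-1` L).
    apply: compact_closedI => //; apply: continuous_compact => //.
    exact/continuous_subspaceT/unified_inl_continuous.
  rewrite compact_ultra in cKL.
  by have [z [[_ Lz] Fz]] := cKL F FU (filterI FK FL); exists z.
have FfL : (fU @ F) L by [].
have [y [Ly Fy]] := cL (fU @ F) _ FfL.
exists (inr y); split => // A.
move=> /unified_nbhsP[W [[V oV ->]|[V [K [oV cK ->]]]] [Wy WA]].
  by case: Wy.
case: Wy => /= Vy _; apply: (filterS WA); apply: filterI.
  (* If the complement were in F, then y would not be a cluster point. *)
  have [//|FV] := in_ultra_setVsetC (fU @^-1` V) FU.
  have nV : nbhs y V by exact: open_nbhs_nbhs.
  by have [t [nVt Vt]] := Fy (~` V) V FV nV.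
have [FK|//] := in_ultra_setVsetC (inl @` K) FU.
by exfalso; apply: noK; exists K.
Qed.

End unified_topology.

(** * The extension of C_0(Y) by C_0(X) *)

Section unified_functions.
Variables (R : realType) (X Y : topologicalType).
Variables (hX : hausdorff_space X) (hY : hausdorff_space Y).
Variables (f : X -> Y) (cf : continuous f).
Local Notation C := (R[i]^o).
Local Notation U := (unified hX cf).
Local Notation fU := (@unified_map X Y hX f cf).

Fact unified_incP (b : C0 R X) :
  C0_set ((fun z => if z is inl x then b x else 0) : U -> C).
Proof.
have [bc b0] := fun_algP b; split.
  move=> z.
  apply/(@cvgrPdist_lt _ _ _ _ (nbhs_filter z)) => e e0; apply/unified_nbhsP.
  case: z => [x|y].
    have /cvgrPdist_lt /(_ _ e0) := bc x.
    rewrite nbhsE => -[V [oV Vx] VA]; exists (inl @` V); first by left; exists V.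
    by split; [exists x|move=> _ [t Vt <-]; exact: VA].
  case/complex_gt0P : e0 => r r0 ->; have [K cK bK] := b0 _ r0.
  exists (fU @^-1` setT `&` ~` (inl @` K)).
    by right; exists setT, K; split => //; exact: openT.
  split; first by split=> // -[].
  move=> [t|t] [_ Kt] /=; rewrite sub0r normrN; last by rewrite normr0 ltcR.
  by apply: bK => Kt'; apply: Kt; exists t.
move=> e e0; have [K cK bK] := b0 e e0; exists (inl @` K).
  apply: continuous_compact => //.
  exact/continuous_subspaceT/unified_inl_continuous.
move=> [x|y] nK; last by rewrite normr0 ltcR.
by apply: bK => Kx; apply: nK; exists x.
Qed.

Definition unified_inc (b : C0 R X) : C0 R U := mkC0 (unified_incP b).

Fact unified_quoP (k : C0 R U) : C0_set ((fun y => k (inr y)) : Y -> C).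
Proof.
have [kc k0] := fun_algP k; split.
  move=> y; apply: (@continuous_comp _ _ _ (inr : Y -> U)).
    exact: unified_inr_continuous.
  exact: kc.
move=> e /k0[K cK kK]; exists (fU @` K).
  apply: continuous_compact => //.
  exact/continuous_subspaceT/unified_map_continuous.
by move=> y nK; apply: kK => Ky; apply: nK; exists (inr y).
Qed.

Definition unified_quo (k : C0 R U) : C0 R Y := mkC0 (unified_quoP k).

Fact unified_splitP (h : C0 R Y) : C0_set (h \o fU : U -> C).
Proof.
have [hc h0] := fun_algP h; split.
  move=> z; apply: continuous_comp; first exact: unified_map_continuous.
  exact: hc.
move=> e /h0[K cK hK]; exists (fU @^-1` K); first exact: unified_map_proper.
by move=> z nK; apply: hK.
Qed.

Definition unified_split (h : C0 R Y) : C0 R U := mkC0 (unified_splitP h).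

Fact unified_inc_hom : star_hom unified_inc.
Proof.
split=> [c a b|a b|a]; apply: fun_alg_eq => -[x|y] //=.
- by rewrite mulr0 addr0.
- by rewrite mulr0.
- by rewrite rmorph0.
Qed.

Fact unified_quo_hom : star_hom unified_quo.
Proof. by split=> [c a b|a b|a]; apply: fun_alg_eq. Qed.

Lemma unified_split_hom : star_hom unified_split.
Proof. by split=> [c a b|a b|a]; apply: fun_alg_eq. Qed.

Fact unified_inc_inj : injective unified_inc.
Proof.
move=> a b ab; apply: fun_alg_eq => x.
exact: (congr1 (fun k : C0 R U => k (inl x)) ab).
Qed.

Lemma unified_splitK h : unified_quo (unified_split h) = h.
Proof. exact: fun_alg_eq. Qed.

Fact unified_quo_surj h : exists k, unified_quo k = h.
Proof. by exists (unified_split h); exact: unified_splitK. Qed.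

(** If [k] vanishes on [Y], the points where [e <= |k|] form a compact set
  that stays inside [X], so that the restriction of [k] to [X] vanishes at
  infinity. *)
Fact unified_exact k : unified_quo k = 0 <-> exists b, unified_inc b = k.
Proof.
split=> [k0|[b <-]]; last exact: fun_alg_eq.
have kY y : k (inr y) = 0.
  by have := congr1 (fun h : C0 R Y => h y) k0.
have [kc kv] := fun_algP k.
have bP : C0_set ((fun x => k (inl x)) : X -> C).
  split.
    move=> x; apply: (@continuous_comp _ _ _ (inl : X -> U)).
      exact: unified_inl_continuous.
    exact: kc.
  move=> e e0; have [K cK kK] := kv e e0.
  have eR : (e%:C)%C \is @Num.real R[i] by rewrite ger0_real // ler0c ltW.
  pose S : set U := [set z | (e%:C)%C <= `|k z|].
  have SX : S `<=` range inl.
    move=> [x|y]; first by exists x.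
    by rewrite /S /= kY normr0 lecR leNgt e0.
  exists (inl @^-1` S).
    apply: unified_inl_compact => //; apply: subclosed_compact cK _; last first.
      move=> z Sz; apply: contrapT => /kK kz.
      by have := le_lt_trans (Sz : (e%:C)%C <= `|k z|) kz; rewrite ltxx.
    rewrite -[S]setCK; apply: open_closedC; rewrite openE => z /negP.
    rewrite /interior /S /= -real_ltNge ?normr_real // => kz.
    apply: filterS (cvgr_norm_lt _ (kc z) _ kz) => t kt /=.
    by rewrite /S /=; apply/negP; rewrite -real_ltNge ?normr_real.
  by move=> x /negP; rewrite -real_ltNge ?normr_real.
exists (mkC0 bP); apply: fun_alg_eq => -[x|y] //=.
Qed.

Definition unified_ext : extension (C0 R X) (C0 R U) (C0 R Y) :=
  Extension unified_inc_hom unified_quo_hom unified_inc_inj unified_quo_surj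
    unified_exact.

End unified_functions.

(** * The Busby invariant and the pullback description *)

Section pullback_multipliers.
Variables (R : realType) (X Y : topologicalType).
Variables (f : X -> Y) (cf : continuous f).
Local Notation C := (R[i]^o).

Lemma pullback_hom : star_hom (fun h : C0 R Y => Cb_mult (pullback cf h)).
Proof.
split=> [c a b|a b|a]; apply: multiplier_eq => u; apply: fun_alg_eq => x /=.
- by rewrite mulrDl mulrA.
- by rewrite mulrA.
- by [].
Qed.

(** Given [b] small off a compact set [K], a function [h] equal to [1] on
  [f @` K] makes [(h \o f) b] uniformly close to [b], so single products are
  already dense. *)
Lemma pullback_Mor (hY : hausdorff_space Y) (lY : locally_compact [set: Y]) :
  Mor (fun h : C0 R Y => Cb_mult (pullback cf h)).
Proof.
split; first exact: pullback_hom.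
move=> O [b Ob] oO.
have /nbhs_ballP[e /= e0 eO] : nbhs b O by exact: open_nbhs_nbhs.
case/complex_gt0P : e0 eO => r r0 -> rO.
have r20 : 0 < r / 2 by rewrite divr_gt0.
have [bc b0] := fun_algP b; have [K cK bK] := b0 _ r20.
have cfK : compact (f @` K).
  by apply: continuous_compact => //; exact: continuous_subspaceT.
have [h [h01 h1 _]] := @C0_urysohn R Y hY lY _ setT cfK openT (@subsetT _ _).
exists (Cb_mult (pullback cf h) b); split; last first.
  by exists [:: (h, b)]; rewrite big_seq1.
apply: rO; rewrite -ball_normE /=.
apply: (@le_lt_trans _ _ ((r / 2)%:C)%C); last first.
  by rewrite ltcR ltr_pdivrMr // ltr_pMr // ltr1n.
apply: fun_alg_norm_le => [|x /=]; first exact: ltW.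
have /andP[hx0 hx1] := h01 (f x).
have [Kx|/bK/ltW bx] := pselect (K x).
  by rewrite h1 ?mul1r ?subrr ?normr0 ?ler0c ?ltW //; exists x.
rewrite -[X in X - _]mul1r -mulrBl normrM (le_trans _ bx) //.
by rewrite ler_piMl // ger0_norm ?subr_ge0 // gerBl.
Qed.

End pullback_multipliers.

Section busby_of_unified.
Variables (R : realType) (X Y : topologicalType).
Variables (hX : hausdorff_space X) (hY : hausdorff_space Y).
Variables (f : X -> Y) (cf : continuous f).
Local Notation C := (R[i]^o).
Local Notation U := (unified hX cf).
Local Notation ext := (unified_ext R hX hY cf).

Lemma unified_ext_splitting : splitting ext (unified_split hX hY cf).
Proof. by split; [exact: unified_split_hom|exact: unified_splitK]. Qed.

Lemma unified_alpha_split (h : C0 R Y) :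
  ext_alpha ext (unified_split hX hY cf h) = Cb_mult (pullback cf h).
Proof.
apply: multiplier_eq => b; apply: (@ext_inc_inj _ _ _ _ ext).
rewrite [LHS]ext_actE; apply: fun_alg_eq => -[x|y] //=.
by rewrite mulr0.
Qed.

(** The Busby invariant can be computed from any preimage of [h] under the
  restriction to [Y]; for [unified_split h] the action on [C_0(X)] is
  multiplication by [h \o f]. *)
Lemma unified_busby_lift :
  busby_lift ext (fun h => Cb_mult (pullback cf h)).
Proof.
split; first exact: pullback_hom.
move=> h; rewrite -[in RHS](@unified_splitK R X Y hX hY f cf h).
by rewrite (busbyE ext) unified_alpha_split.
Qed.

Fact unified_restrictP (k : C0 R U) : Cb_set ((fun x => k (inl x)) : X -> C).
Proof.
have [kc [M kM]] := C0_in_Cb k; split; last by exists M => x; exact: kM.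
move=> x; apply: (@continuous_comp _ _ _ (inl : X -> U)).
  exact: unified_inl_continuous.
exact: kc.
Qed.

Definition unified_restrict (k : C0 R U) : Cb R X :=
  @FunAlg R X (FunCStar (Cb_closed R X)) _ (unified_restrictP k).

Lemma unified_pullback_iso :
  exists Psi : C0 R U -> (Cb R X * C0 R Y)%type,
    [/\ star_hom Psi, injective Psi & range Psi = unified_pullback cf].
Proof.
exists (fun k => (unified_restrict k, unified_quo k)); split.
- by split=> [c a b|a b|a]; congr pair; apply: fun_alg_eq.
- move=> k l [] kl1 kl2; apply: fun_alg_eq => -[x|y].
    exact: (congr1 (@^~ x) kl1).
  exact: (congr1 (@^~ y) kl2).
- apply/seteqP; split=> [_ [k _ <-]|[g h] /= [b gh]].
    have : unified_quo (k - unified_split hX hY cf (unified_quo k)) = 0.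
      by apply: fun_alg_eq => y /=; rewrite subrr.
    move=> /unified_exact[b bk]; exists b; apply: fun_alg_eq => x /=.
    by have := congr1 (fun l : C0 R U => l (inl x)) bk.
  exists (unified_inc hX cf b + unified_split hX hY cf h) => //.
  congr pair; apply: fun_alg_eq => z /=; last by rewrite add0r.
  have := congr1 (fun l : Cb R X => l z) gh; rewrite /= => <-.
  by rewrite subrK.
Qed.

End busby_of_unified.

(** * Split extensions and their action on the ideal *)

Section split_extensions.
Variable R : realType.
Implicit Types A B E F : cstarAlgType R.

Lemma star_homD A B (g : A -> B) : star_hom g -> {morph g : u v / u + v}.
Proof. by move=> [gL _ _] u v; rewrite -[u]scale1r gL !scale1r. Qed.

Lemma star_homB A B (g : A -> B) : star_hom g -> {morph g : u v / u - v}.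
Proof.
by move=> [gL _ _] u v; rewrite -scaleN1r addrC gL scaleN1r addrC.
Qed.

(** The map [i b + s a |-> i' b + s' a] between two split extensions.  The
  choice operator avoids carrying along the projection from [E] to its ideal;
  the choice is unique by [split_mapE]. *)
Definition split_map B E F A (ext : extension B E A) (ext' : extension B F A)
    (s : A -> E) (s' : A -> F) (e : E) : F :=
  xget 0 [set e' | exists b a,
    e = ext_inc ext b + s a /\ e' = ext_inc ext' b + s' a].

Lemma split_mapE B E F A (ext : extension B E A) (ext' : extension B F A) s s' :
  splitting ext s ->
  forall b a, split_map ext ext' s s' (ext_inc ext b + s a) =
    ext_inc ext' b + s' a.
Proof.
move=> [sH qs] b a; rewrite /split_map.
case: xgetP => [e' _|/(_ (ext_inc ext' b + s' a))].
  move=> [b' [a' [ee' ->]]].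
  have qi c : ext_quo ext (ext_inc ext c) = 0 by apply/ext_exact; exists c.
  have aa' : a = a'.
    have := congr1 (ext_quo ext) ee'.
    by rewrite !(star_homD (ext_quo_hom ext)) !qi !add0r !qs.
  by move: ee'; rewrite aa' => /addIr /(@ext_inc_inj _ _ _ _ ext) ->.
by case; exists b, a.
Qed.

Lemma split_decomposition B E A (ext : extension B E A) s :
  splitting ext s -> forall e, exists b a, e = ext_inc ext b + s a.
Proof.
move=> [sH qs] e.
have /ext_exact[b be] : ext_quo ext (e - s (ext_quo ext e)) = 0.
  by rewrite (star_homB (ext_quo_hom ext)) qs subrr.
by exists b, (ext_quo ext e); rewrite be subrK.
Qed.

(** The product in a split extension depends only on the two algebras and on
  the action of the splitting on the ideal; multiplication from the right is
  expressed by the action through the involution. *)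
Lemma split_mul B E A (ext : extension B E A) s : splitting ext s ->
  forall b a c d, smul (ext_inc ext b + s a) (ext_inc ext c + s d) =
    ext_inc ext (smul b c + ext_alpha ext (s a) c
      + star (ext_alpha ext (s (star d)) (star b))) + s (smul a d).
Proof.
move=> [[sL sM sJ] qs] b a c d; have iH := ext_inc_hom ext.
have [iL iM iJ] := iH.
rewrite !(star_homD iH) iM iJ /= !ext_actE iJ starM starK sJ starK.
by rewrite smulDl !smulDr sM !addrA; congr (_ + _); rewrite addrAC.
Qed.

(** By [split_mul], two splittings that act alike on the ideal give the same
  multiplication, so that [split_map] is multiplicative; exchanging the roles
  of the extensions gives its inverse. *)
Lemma split_extension_iso B E F A (ext : extension B E A)
    (ext' : extension B F A) s s' :
  splitting ext s -> splitting ext' s' ->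
  (forall a, ext_alpha ext (s a) = ext_alpha ext' (s' a)) ->
  extension_iso ext ext' (split_map ext ext' s s') /\
    forall a, split_map ext ext' s s' (s a) = s' a.
Proof.
move=> sP s'P ss'; set Phi := split_map _ _ _ _.
have PhiE := split_mapE ext' s' sP : forall b a, Phi _ = _.
have [[sL sM sJ] qs] := sP; have [[sL' sM' sJ'] qs'] := s'P.
have iH := ext_inc_hom ext; have iH' := ext_inc_hom ext'.
have [iL iM iJ] := iH; have [iL' iM' iJ'] := iH'.
have i0 : ext_inc ext 0 = 0 by rewrite -(subrr 0) (star_homB iH) subrr.
have i0' : ext_inc ext' 0 = 0 by rewrite -(subrr 0) (star_homB iH') subrr.
have s0 : s 0 = 0 by rewrite -(subrr 0) (star_homB sP.1) subrr.
have s0' : s' 0 = 0 by rewrite -(subrr 0) (star_homB s'P.1) subrr.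
split; [split; [split| | |]|].
- move=> x u v; have [b [a ->]] := split_decomposition sP u.
  have [c [d ->]] := split_decomposition sP v.
  by rewrite scalerDr addrACA -iL -sL !PhiE iL' sL' scalerDr addrACA.
- move=> u v; have [b [a ->]] := split_decomposition sP u.
  have [c [d ->]] := split_decomposition sP v.
  by rewrite (split_mul sP) !PhiE (split_mul s'P) !ss'.
- move=> u; have [b [a ->]] := split_decomposition sP u.
  by rewrite starD -iJ -sJ !PhiE starD iJ' sJ'.
- exists (split_map ext' ext s' s) => u.
    have [b [a ->]] := split_decomposition sP u.
    by rewrite PhiE (split_mapE _ _ s'P).
  have [b [a ->]] := split_decomposition s'P u.
  by rewrite (split_mapE _ _ s'P) PhiE.
- by move=> b; have := PhiE b 0; rewrite s0 s0' !addr0.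
- move=> u; have [b [a ->]] := split_decomposition sP u.
  rewrite PhiE (star_homD (ext_quo_hom ext)) (star_homD (ext_quo_hom ext')).
  rewrite qs qs' (ext_exact ext _).2; last by exists b.
  by rewrite (ext_exact ext' _).2 //; exists b.
- by move=> a; have := PhiE 0 a; rewrite i0 i0' !add0r.
Qed.

End split_extensions.

(** * Nondegenerate morphisms from C_0(Y) to M(C_0(X)) *)

Section morphisms_of_C0.
Variables (R : realType) (X Y : topologicalType).
Hypotheses (hX : hausdorff_space X) (lX : locally_compact [set: X]).
Hypotheses (hY : hausdorff_space Y) (lY : locally_compact [set: Y]).

Lemma multiplier_smul (B : cstarAlgType R) (T : multiplier B) a b :
  T (smul a b) = smul (T a) b.
Proof. by apply: star_smul_inj => c; rewrite multPr !smulA -multPr. Qed.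

(** Multipliers commute with multiplication by elements of the algebra, hence
  [T b * c = T (b * c) = T c * b]: the ratio [T b / b] is the same for all
  [b], which is how [T] becomes multiplication by a function. *)
Lemma multiplier_C0 (T : multiplier (C0 R X)) (b c : C0 R X) x :
  T b x * c x = T c x * b x.
Proof.
have bc : smul b c = smul c b by apply: fun_alg_eq => t /=; rewrite mulrC.
have := congr1 (fun d : C0 R X => d x) (congr1 T bc).
by rewrite !multiplier_smul.
Qed.

Lemma C0_peak (x : X) : exists b : C0 R X, b x = 1.
Proof.
have [b [_ b1 _]] :=
  @C0_urysohn R X hX lX _ setT (@compact_set1 _ x) openT (@subsetT _ _).
by exists b; exact: b1.
Qed.

(** With [b x = 1], the map [h |-> phi h b x] is a character of [C_0(Y)].  If
  it were zero, every element of the span of the [phi h c] would vanish at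
  [x], and none could be close to [b]. *)
Lemma Mor_pointwise (phi : C0 R Y -> multiplier (C0 R X)) : Mor phi ->
  forall x, exists y, forall h b, phi h b x = h y * b x.
Proof.
move=> [[pL pM pJ] pD] x; have [b bx] := C0_peak x.
have phiE h c : phi h c x = phi h b x * c x.
  by rewrite -[LHS]mulr1 -bx multiplier_C0.
pose chi h := phi h b x.
have chiL (a : R[i]) u v : chi (a *: u + v) = a * chi u + chi v.
  by rewrite /chi pL.
have chiM u v : chi (smul u v) = chi u * chi v by rewrite /chi pM /= phiE.
have chiJ u : chi (star u) = Num.conj (chi u).
  have := congr1 (fun d : C0 R X => d x) (multP (phi u) b b).
  by rewrite /chi pJ /= bx rmorph1 mulr1 mul1r.
have chi0 : exists h, chi h != 0.
  apply: contrapT => /forallNP n0.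
  have phi0 h c : phi h c x = 0.
    rewrite phiE; have /negP := n0 h; rewrite negbK => /eqP.
    by rewrite /chi => ->; rewrite mul0r.
  have : ball b 1 !=set0 by exists b; exact: ballxx.
  have oB : open (ball b (1 : R[i])) by exact: ball_open.
  move=> /pD /(_ oB)[c [bc [s cs]]].
  have cx : c x = 0.
    rewrite cs; elim/big_rec: _ => // p d _ /= dx.
    by rewrite phi0 add0r.
  move: bc; rewrite -ball_normE /= => /(le_lt_trans (fun_alg_norm_ub _ x)).
  by rewrite /= bx cx subr0 normr1 ltxx.
have [y hy] := character_eval chiL chiM chiJ chi0.
by exists y => h c; rewrite phiE -hy.
Qed.

(** For continuity at [x], take [h] with [h (f x) = 1] that vanishes off a
  given neighbourhood of [f x]; since [phi h b = (h \o f) * b] is continuous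
  and nonzero at [x], it is nonzero near [x], which forces [f] into that
  neighbourhood. *)
Lemma Mor_pullback (phi : C0 R Y -> multiplier (C0 R X)) : Mor phi ->
  exists (f : X -> Y) (cf : continuous f),
    forall h, phi h = Cb_mult (pullback cf h).
Proof.
move=> phiM; have /choice[f fE] := Mor_pointwise phiM.
have cf : continuous f.
  move=> x A; rewrite nbhsE => -[V [oV Vx] VA].
  have fxV : [set f x] `<=` V by move=> _ ->.
  have [h [_ h1 h0]] := @C0_urysohn R Y hY lY _ _ (@compact_set1 _ (f x)) oV fxV.
  have [b bx] := C0_peak x; have [pc _] := fun_algP (phi h b).
  have : phi h b x != 0 by rewrite fE h1 // bx mulr1 oner_neq0.
  move=> /(cvgr_neq0 _ (pc x)); apply: filterS => t /=.
  rewrite fE => ht; apply: VA; apply: contrapT => /h0 ht0.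
  by move: ht; rewrite ht0 mul0r eqxx.
exists f, cf => h; apply: multiplier_eq => b; apply: fun_alg_eq => x.
by rewrite fE.
Qed.

End morphisms_of_C0.

(** * Split extensions and unified spaces *)

Theorem theorem3p17 (R : realType) (X Y : topologicalType)
    (hX : hausdorff_space X) (lX : locally_compact [set: X])
    (hY : hausdorff_space Y) (lY : locally_compact [set: Y]) :
  (forall (f : X -> Y) (cf : continuous f),
     exists (ext : extension (C0 R X) (C0 R (unified hX cf)) (C0 R Y))
            (s : C0 R Y -> C0 R (unified hX cf)),
     [/\ unified_extension ext,
         splitting ext s /\ (forall h z, s h z = h (unified_map z)),
         Mor (fun h : C0 R Y => Cb_mult (pullback cf h)) /\
           busby_lift ext (fun h => Cb_mult (pullback cf h)) &
         exists Psi : C0 R (unified hX cf) -> (Cb R X * C0 R Y)%type,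
           [/\ star_hom Psi, injective Psi &
               range Psi = unified_pullback cf]])
  /\
  (forall (E : cstarAlgType R) (ext : extension (C0 R X) E (C0 R Y))
          (s : C0 R Y -> E),
     splitting ext s -> Mor (fun h => ext_alpha ext (s h)) ->
     exists (f : X -> Y) (cf : continuous f)
            (ext' : extension (C0 R X) (C0 R (unified hX cf)) (C0 R Y))
            (Phi : E -> C0 R (unified hX cf)),
     [/\ unified_extension ext', extension_iso ext ext' Phi &
         forall h z, Phi (s h) z = h (unified_map z)]).
Proof.
split=> [f cf|E ext s sP phiM].
  exists (unified_ext R hX hY cf), (unified_split hX hY cf); split.
  - by [].
  - by split; first exact: unified_ext_splitting.
  - by split; [exact: pullback_Mor|exact: unified_busby_lift].
  - exact: unified_pullback_iso.
have [f [cf phiE]] := Mor_pullback hX lX hY lY phiM.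
have alphaE h : ext_alpha ext (s h) =
    ext_alpha (unified_ext R hX hY cf) (unified_split hX hY cf h).
  by rewrite phiE unified_alpha_split.
have [iso isoE] :=
  split_extension_iso sP (unified_ext_splitting R hX hY cf) alphaE.
exists f, cf, (unified_ext R hX hY cf), (split_map ext (unified_ext R hX hY cf)
  s (unified_split hX hY cf)); split=> // h z.
by rewrite isoE.
Qed.
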